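(* For $N\ge3$ set $m_N:=\lfloor N/4\rfloor$ and $r_N:=N-4m_N\in\{0,1,2,3\}$. There are pairwise distinct numbers $\eta_{1,N},\ldots,\eta_{m_N,N}>0$ such that $$Q_{N,\pi/2}(z)=z^{r_N}\prod_{j=1}^{m_N}\bigl(z^4+\eta_{j,N}\bigr).$$ In particular, every nonzero root of $Q_{N,\pi/2}$ is simple and $$\{z\in\mathbb C:Q_{N,\pi/2}(z)=0\}\subset\mathcal X_{\pi/4}.$$
   Context: Indices of $\mathbb C^N$ are in $\mathbb Z/N\mathbb Z$, represented by $0,\dots,N-1$. For $|\tau|=1$ let $S_\tau e_j=e_{j+1}$ for $0\le j<N-1$, $S_\tau e_{N-1}=\tau e_0$. Set $D_N(\vartheta)=\operatorname{diag}\bigl(\cos(\tfrac{2\pi j}{N}+\vartheta)\bigr)_{j}$, $A_N^\tau(\varphi,\vartheta)=e^{i\varphi}\frac{S_\tau+S_\tau^{-1}}2+D_N(\vartheta)$ (superscript $\tau$ is the boundary twist, not a power), and $\chi^{\tau}_{N,\varphi,\vartheta}(z)=\det\bigl(zI-A_N^\tau(\varphi,\vartheta)\bigr)$. $Q_{N,\varphi}(z)$ denotes the monic polynomial, independent of $\vartheta$ and $\tau$, characterized by $$\chi^{e^{i\kappa}}_{N,\varphi,\vartheta}(z)=Q_{N,\varphi}(z)-2^{1-N}\cos(N\vartheta)-2^{1-N}e^{iN\varphi}\cos\kappa\qquad\text{for all }\vartheta,\kappa\in\mathbb R;$$ explicitly, $Q_{N,\varphi}(z)=\chi^{1}_{N,\varphi,0}(z)+2^{1-N}+2^{1-N}e^{iN\varphi}$.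 $\mathcal X_{\pi/4}:=e^{i\pi/4}\mathbb R\cup e^{3i\pi/4}\mathbb R$. *)

(* Defs.v *)
From HB Require Import structures.
From mathcomp Require Import all_boot all_order all_algebra.
From mathcomp Require Import complex.
From mathcomp Require Import all_classical all_reals all_analysis.
Set Implicit Arguments.
Unset Strict Implicit.
Unset Printing Implicit Defensive.
Import Order.TTheory GRing.Theory Num.Theory.
Local Open Scope classical_set_scope.
Local Open Scope ring_scope.
Local Open Scope complex_scope.

Section Model.
Variable R : realType.

Definition expi (t : R) : R[i] := cos t +i* sin t.

(* Matrices act on column vectors: column j of [shift_mx N tau] is
   S_tau e_j, namely e_{j+1} if j < N - 1 and tau e_0 if j = N - 1. *)
Definition shift_mx (N : nat) (tau : R[i]) : 'M[R[i]]_N :=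
  \matrix_(i < N, j < N)
    if (j.+1 < N)%N then ((i == j.+1 :> nat)%:R : R[i])
    else tau * (i == 0%N :> nat)%:R.

Definition diag_part (N : nat) (theta : R) : 'M[R[i]]_N :=
  diag_mx (\row_(j < N) (cos (2 * pi * j%:R / N%:R + theta))%:C).

Definition twisted_mx (N : nat) (tau : R[i]) (phi theta : R) : 'M[R[i]]_N :=
  (expi phi / 2) *: (shift_mx N tau + invmx (shift_mx N tau))
  + diag_part N theta.

Definition chi (N : nat) (tau : R[i]) (phi theta : R) : {poly R[i]} :=
  char_poly (twisted_mx N tau phi theta).

Definition Qpoly (N : nat) (phi : R) : {poly R[i]} :=
  chi N 1 phi 0
  + (2 ^ (1 - N%:Z) + 2 ^ (1 - N%:Z) * expi (N%:R * phi))%:P.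

Definition cross_pi4 : set R[i] :=
  range (fun t : R => expi (pi / 4) * t%:C)
  `|` range (fun t : R => expi (3 * pi / 4) * t%:C).

(* [Qpoly N phi] is the only polynomial that can satisfy the Chambers-type
   relation for all theta and kappa. *)
Lemma Qpoly_unique (N : nat) (phi : R) (Q : {poly R[i]}) :
  (forall theta kappa : R,
     chi N (expi kappa) phi theta =
     Q - (2 ^ (1 - N%:Z) * (cos (N%:R * theta))%:C)%:P
       - (2 ^ (1 - N%:Z) * expi (N%:R * phi) * (cos kappa)%:C)%:P) ->
  Q = Qpoly N phi.
Proof.
have e0 : expi 0 = 1 by rewrite /expi cos0 sin0.
move=> /(_ 0 0); rewrite /Qpoly e0 mulr0 cos0 !mulr1 => ->.
by rewrite polyCD -[_ - _ - _]addrA -opprD subrK.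
Qed.

End Model.

Arguments cross_pi4 : clear implicits.

(* Main.v *)
(** Harper's matrix is built from a Weyl pair [U], [V].  In the chiral gauge
    [V] is a cyclic shift and [U] a diagonal matrix times [V], so that the
    matrix becomes a periodic Jacobi matrix with zero diagonal.  At
    [phi = pi / 2], for a suitable twist, one bond of the cycle vanishes and the
    product of the two amplitudes on bond [k] is [i sin (2 pi k / N) / 2].
    A Chambers-type argument (a Laurent polynomial of degree [N] in the twist
    that is invariant under rotation by [2 pi / N] only has exponents
    [-N], [0], [N]) shows that [Qpoly] is the determinant of the resulting path,
    a continuant.

    The weights [sin (2 pi k / N)] are antisymmetric under reversal of the path.
    Reversal therefore turns [z] into [i z], so only the exponents congruent to
    [N] modulo 4 occur.  On the first half of the path the weights are
    positive, and Sturm's theorem provides [N %/ 4] positive zeros of the half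
    continuant, at which the full one vanishes ([N] even) or alternates in sign
    ([N] odd).  This gives [N %/ 4] distinct values of [z ^ 4], which is all of
    them by degree. *)
Require Import Defs.
From mathcomp Require Import all_boot all_order all_algebra.
From mathcomp Require Import perm complex.
From mathcomp Require Import all_classical all_reals all_analysis.
From mathcomp Require Import ring lra zify.
From mathcomp Require polyrcf.
Import Order.TTheory GRing.Theory Num.Theory.
Local Open Scope classical_set_scope.
Local Open Scope ring_scope.
Local Open Scope complex_scope.

Set Implicit Arguments.
Unset Strict Implicit.
Unset Printing Implicit Defensive.

(* [contin z w n.+1] is the characteristic determinant of a zero-diagonal
   Jacobi matrix on [n] sites, [w k] being the product of the two hopping
   amplitudes between sites [k - 1] and [k]. *)
Fixpoint contin (K : comPzRingType) (z : K) (w : nat -> K) (n : nat) : K :=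
  match n with
  | 0 => 0
  | n1.+1 => match n1 with
             | 0 => 1
             | n2.+1 => z * contin z w n1 - w n2 * contin z w n2
             end
  end.

Lemma nat_ind2 (P : nat -> Prop) :
  P 0%N -> P 1%N -> (forall n, P n -> P n.+1 -> P n.+2) -> forall n, P n.
Proof.
move=> P0 P1 PS n; suff [] : P n /\ P n.+1 by [].
by elim: n => [|n [Pn PSn]]; split=> //; apply: PS.
Qed.

(** * Continuants: rescaling and reversal of the path *)

Section Continuant.
Variable K : comPzRingType.
Implicit Types (z c : K) (w : nat -> K).

Lemma continSS z w n :
  contin z w n.+2 = z * contin z w n.+1 - w n * contin z w n.
Proof. by []. Qed.

Lemma eq_contin z w w' n :
  (forall k, (k.+1 < n)%N -> w k = w' k) -> contin z w n = contin z w' n.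
Proof.
elim/nat_ind2: n => // n IH0 IH1 eqw.
by rewrite !continSS eqw// IH0 ?IH1// => k kn; apply: eqw; lia.
Qed.

Lemma rmorph_contin (L : comPzRingType) (f : {rmorphism K -> L}) z w n :
  f (contin z w n) = contin (f z) (f \o w) n.
Proof.
elim/nat_ind2: n => [||n IH0 IH1]; rewrite ?rmorph0 ?rmorph1 //.
by rewrite !continSS rmorphB !rmorphM IH0 IH1.
Qed.

(** A continuant is homogeneous when [z] has degree 1 and [w] degree 2; the extra factor [c] on the
    left avoids the exponent [n.-1]. *)
Lemma contin_scale z c w n :
  c * contin (c * z) (fun k => c ^+ 2 * w k) n = c ^+ n * contin z w n.
Proof.
elim/nat_ind2: n => [||n IH0 IH1]; rewrite ?mulr0 ?mulr1 //.
rewrite !continSS mulrBr [c * (c * z * _)]mulrCA IH1.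
rewrite [c * (c ^+ 2 * _ * _)]mulrCA IH0 !exprS expr0; ring.
Qed.

(** Expansion across bond [N - j]. The far piece is read from the other end of the path, where
    antisymmetry turns its weights into [- w k]. *)
Lemma contin_split z w N j :
  (forall k, (k <= N)%N -> w (N - k)%N = - w k) -> (j <= N)%N ->
  contin z w N.+1 =
    contin z w (N - j).+1 * contin z (fun k => - w k) j.+1
    - w (N - j)%N * contin z w (N - j) * contin z (fun k => - w k) j.
Proof.
move=> asym; elim: j => [_|j IH jN]; first by rewrite subn0 /=; ring.
rewrite IH; last exact: ltnW.
rewrite -(subSn jN) subSS asym ?(ltnW jN)//.
have -> : (N - j = (N - j.+1).+1)%N by rewrite -subSn.
by rewrite !continSS; ring.
Qed.

Lemma contin_antisym z w N :
  (forall k, (k <= N)%N -> w (N - k)%N = - w k) ->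
  contin z w N.+1 = contin z (fun k => - w k) N.+1.
Proof.
by move=> /contin_split -/(_ z N (leqnn N)) ->; rewrite subnn /=; ring.
Qed.

End Continuant.

(** * Sturm's theorem for positive weights *)

Section Sturm.
Variable R : rcfType.

Definition cpoly (w : nat -> R) n : {poly R} := contin 'X (polyC \o w) n.

Lemma horner_cpoly w n x : (cpoly w n).[x] = contin x w n.
Proof.
rewrite /cpoly -[LHS]/(horner_eval x _) rmorph_contin /= horner_evalE hornerX.
by apply: eq_contin => k _ /=; rewrite horner_evalE hornerC.
Qed.

Lemma cpoly_monic_size w n :
  (cpoly w n.+1 \is monic) /\ size (cpoly w n.+1) = n.+1.
Proof.
suff [] : ((cpoly w n.+1 \is monic) /\ size (cpoly w n.+1) = n.+1) /\
          (size (cpoly w n) = n) by [].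
elim: n => [|n [[mon sz] sz']].
  by rewrite /cpoly /= monic1 size_poly1 size_poly0.
split=> //; rewrite /cpoly continSS -!/(cpoly _ _).
have szX : size ('X * cpoly w n.+1) = n.+2.
  by rewrite size_monicM ?monicX ?monic_neq0// size_polyX sz.
have lt : (size (- ((polyC \o w) n * cpoly w n))%R < size ('X * cpoly w n.+1)%R)%N.
  rewrite size_polyN szX /= mul_polyC.
  by rewrite (leq_ltn_trans (size_scale_leq _ _))// sz'.
split; last by rewrite size_polyDl.
by rewrite monicE lead_coefDl// -monicE monicMl ?monicX.
Qed.

Lemma cpoly_monic w n : cpoly w n.+1 \is monic.
Proof. by case: (cpoly_monic_size w n). Qed.

Lemma size_cpoly w n : size (cpoly w n.+1) = n.+1.
Proof. by case: (cpoly_monic_size w n). Qed.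

Lemma contin_opp x (w : nat -> R) n :
  contin (- x) w n.+1 = (-1) ^+ n * contin x w n.+1.
Proof.
have := contin_scale x (-1) w n.+1; rewrite sqrrN expr1n.
rewrite (@eq_contin _ _ _ w); last by move=> k _; rewrite mul1r.
rewrite !mulN1r exprS => /eqP; rewrite mulN1r mulNr eqr_opp => /eqP.
by [].
Qed.

(** The intermediate value theorem in each gap between consecutive [x j], and to the right of [x 0],
    where [f] starts negative and, being monic, ends positive. *)
Lemma alternating_roots (f : {poly R}) n (x : nat -> R) :
  f \is monic ->
  (forall j, (j < n)%N -> 0 < (-1) ^+ j.+1 * f.[x j]) ->
  (forall i j, (i < j < n)%N -> x j < x i) ->
  exists y : nat -> R, forall j, (j < n)%N ->
    [/\ root f (y j), x j < y j & forall i, (i < j)%N -> y j < x i].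
Proof.
move=> fmon falt xdec.
suff H j : exists yj, (j < n)%N ->
    [/\ root f yj, x j < yj & forall i, (i < j)%N -> yj < x i].
  by have [y yP] := choice H; exists y.
case: (ltnP j n) => [jn|]; last by exists 0.
case: j jn => [|j] jn.
  have [M MP] : exists M, forall t, M <= t -> lead_coef f <= f.[t].
    by apply: polyrcf.poly_pinfty_gt_lc; rewrite (monicP fmon).
  have := falt _ jn; rewrite expr1 mulN1r oppr_gt0 => fx0.
  have xM : x 0%N <= Num.max M (x 0%N) by rewrite le_max lexx orbT.
  have fM : 0 < f.[Num.max M (x 0%N)].
    by apply: lt_le_trans (MP _ _); rewrite ?(monicP fmon)// le_max lexx.
  have [|y] := @polyrcf.poly_ivtoo _ f _ _ xM; first by rewrite pmulr_llt0.
  by rewrite in_itv /= => /andP[xy _] ry; exists y.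
have xx : x j.+1 < x j by apply: xdec; rewrite ltnSn.
have [|y] := @polyrcf.poly_ivtoo _ f _ _ (ltW xx).
  have := falt _ jn; have := falt _ (ltnW jn).
  rewrite !exprS -signr_odd; case: (odd j); rewrite ?expr0 ?expr1; nra.
rewrite in_itv /= => /andP[xy yx] ry; exists y => _; split=> // i ij.
have [->//|ne] := eqVneq i j.
by apply: lt_trans yx (xdec _ _ _); lia.
Qed.

Lemma sign_prod_roots n (x : nat -> R) j (y : R) : (j <= n)%N ->
  (forall i, (i < j)%N -> y < x i) ->
  (forall i, (j <= i < n)%N -> x i < y) ->
  0 < (-1) ^+ j * \prod_(i < n) (y - x i).
Proof.
move=> jn lo hi.
rewrite -(subnKC jn) big_split_ord /= mulrA -[in (-1) ^+ _](card_ord j).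
rewrite -prodr_const -big_split /= mulr_gt0// prodr_gt0// => i _.
  by have := lo _ (ltn_ord i); lra.
have := hi (j + i)%N; rewrite subr_gt0; apply.
by have := ltn_ord i; lia.
Qed.

Lemma horner_prod_XsubC n (x : nat -> R) y :
  (\prod_(i < n) ('X - (x i)%:P)).[y] = \prod_(i < n) (y - x i).
Proof. by rewrite horner_prod; apply: eq_bigr => i _; rewrite hornerXsubC. Qed.

(** The third clause drives the induction: alternation of the previous continuant at the zeros gives
    sign changes of the next one, hence its zeros; these interlace with the old ones, which
    reproduces the clause. *)
Lemma cpoly_sturm (s : nat -> R) n :
  (forall k, (0 < k < n)%N -> 0 < s k) ->
  exists x : nat -> R,
    [/\ forall i j, (i < j < n)%N -> x j < x i,
        cpoly s n.+1 = \prod_(i < n) ('X - (x i)%:P)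
      & forall j, (j < n)%N -> 0 < (-1) ^+ j * contin (x j) s n].
Proof.
elim: n => [|n IH] spos.
  by exists (fun=> 0); split=> [i j||//]; rewrite ?andbF// big_ord0.
have [k /andP[k0 kn]|x [xdec xprod xalt]] := IH.
  by apply: spos; rewrite k0 ltnW.
have xroot j : (j < n)%N -> contin (x j) s n.+1 = 0.
  move=> jn; rewrite -horner_cpoly xprod horner_prod_XsubC.
  by rewrite (bigD1 (Ordinal jn))//= subrr mul0r.
pose h := cpoly s n.+2.
have hmon : h \is monic by exact: cpoly_monic.
have [M MP] : exists M, forall t, M <= t -> lead_coef h <= h.[t].
  by apply: polyrcf.poly_pinfty_gt_lc; rewrite (monicP hmon).
(* The lowest zero needs one more sample point, [- L], to the left of all [x j]. As [M <= L], [h] is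
   positive at [L], and its parity gives the sign at [- L]. *)
pose L := Num.max M (1 - x n.-1).
pose x' j := if (j < n)%N then x j else - L.
have x'dec i j : (i < j < n.+1)%N -> x' j < x' i.
  move=> /andP[ij]; rewrite /x' ltnS leq_eqVlt => /orP[/eqP jn|jn].
    rewrite jn ltnn -jn ij ltrNl /L lt_max; apply/orP; right.
    suff : x n.-1 <= x i by lra.
    have [->|ne] := eqVneq i n.-1; first exact: lexx.
    by apply/ltW/xdec; lia.
  by rewrite jn (ltn_trans ij jn) xdec ?ij.
have halt j : (j < n.+1)%N -> 0 < (-1) ^+ j.+1 * h.[x' j].
  rewrite /x' ltnS leq_eqVlt => /orP[/eqP->|jn].
    rewrite ltnn horner_cpoly contin_opp mulrA -exprD addnn -mul2n.
    rewrite exprM sqrrN !expr1n mul1r -horner_cpoly.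
    by apply: lt_le_trans (MP _ _); rewrite ?(monicP hmon)// le_max lexx.
  (* At a zero of the preceding continuant the recurrence leaves only [- s n * contin (x j) s n]. *)
  rewrite jn horner_cpoly continSS xroot// mulr0 sub0r exprS mulN1r mulrNN.
  rewrite mulrCA mulr_gt0 ?xalt// spos ?ltnSn ?andbT//.
  by case: (n) jn.
have [y yP] := alternating_roots hmon halt x'dec.
have ydec i j : (i < j < n.+1)%N -> y j < y i.
  move=> /andP[ij jn]; have [_ _ /(_ i ij) yx] := yP _ jn.
  have [_ xy _] := yP _ (ltn_trans ij jn).
  exact: lt_trans yx xy.
exists y; split=> //.
  have -> : \prod_(i < n.+1) ('X - (y i)%:P) =
            \prod_(z <- map y (iota 0 n.+1)) ('X - z%:P).
    by rewrite big_map -[iota _ _]/(index_iota 0 n.+1) big_mkord.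
  rewrite -/h [LHS](@all_roots_prod_XsubC _ h (map y (iota 0 n.+1))).
  - by rewrite (monicP hmon) scale1r.
  - by rewrite size_map size_iota size_cpoly.
  - apply/allP => z /mapP[j]; rewrite mem_iota add0n => /andP[_ jn] ->.
    by have [] := yP _ jn.
  - rewrite uniq_rootsE map_inj_in_uniq ?iota_uniq// => i j.
    rewrite !mem_iota !add0n => /andP[_ iN] /andP[_ jN] eqy.
    have [ij|ji|//] := ltngtP i j.
      by have := ydec i j; rewrite ij jN eqy ltxx => /(_ isT).
    by have := ydec j i; rewrite ji iN eqy ltxx => /(_ isT).
move=> j jn; rewrite -horner_cpoly xprod horner_prod_XsubC.
have [_ xy yx] := yP _ jn.
apply: sign_prod_roots => // i.
  by move=> ij; have := yx _ ij; rewrite /x' (leq_trans ij jn).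
move=> /andP[ji iN]; have := xy; rewrite /x' (leq_ltn_trans ji iN).
have [->//|ne] := eqVneq i j.
by apply: lt_trans; apply: xdec; lia.
Qed.

End Sturm.

(** * Positive zeros for positive and for antisymmetric weights *)

Section PositiveRoots.
Variable R : rcfType.

(** By parity the zeros are symmetric about 0; being distinct and in decreasing order, the first
    [n %/ 2] of them are positive. *)
Lemma cpoly_positive_roots (s : nat -> R) n :
  (forall k, (0 < k < n)%N -> 0 < s k) ->
  exists x : nat -> R,
    (forall i j, (i < j < n)%N -> x j < x i) /\
    forall j, (j < n %/ 2)%N ->
      [/\ 0 < x j, contin (x j) s n.+1 = 0
        & 0 < (-1) ^+ j * contin (x j) s n].
Proof.
move=> spos; have [x [xdec xprod xalt]] := cpoly_sturm spos.
exists x; split=> // j jn2.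
have jn : (j < n)%N by lia.
have rootE y : (y \in map x (iota 0 n)) = (contin y s n.+1 == 0).
  rewrite -horner_cpoly xprod horner_prod_XsubC.
  apply/mapP/idP => [[k] |].
    rewrite mem_iota add0n => /andP[_ kn] ->.
    by rewrite (bigD1 (Ordinal kn))//= subrr mul0r.
  rewrite prodf_seq_eq0 => /hasP[k _]; rewrite subr_eq0 /= => /eqP->.
  by exists (k : nat); rewrite // mem_iota add0n /=.
have xjE : contin (x j) s n.+1 = 0.
  by apply/eqP; rewrite -rootE map_f// mem_iota add0n.
split=> //; last exact: xalt.
have gt_irr : irreflexive (fun a b : R => b < a) by move=> a; rewrite ltxx.
have gt_tr : transitive (fun a b : R => b < a).
  by move=> a b c ab bc; apply: lt_trans bc ab.
have sx : sorted (fun a b : R => b < a) (map x (iota 0 n)).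
  apply: (path.homo_sorted_in (P := fun i => (i < n)%N) (e := ltn)).
  - by move=> i k _ kn ik; apply: xdec; apply/andP; split.
  - by apply/allP => i; rewrite mem_iota add0n.
  - exact: iota_ltn_sorted.
have sx' : sorted (fun a b : R => b < a) (rev (map -%R (map x (iota 0 n)))).
  rewrite rev_sorted sorted_map.
  by move: sx; apply: sub_sorted => a b /= ba; rewrite ltrN2.
(* Both lists are strictly decreasing with the same members, so they agree; entry [j] reads
   [x j = - x (n - j.+1)]. *)
have /(congr1 (fun r => nth 0 r j)) :
    map x (iota 0 n) = rev (map -%R (map x (iota 0 n))).
  apply: (irr_sorted_eq gt_tr gt_irr sx sx') => y.
  rewrite mem_rev -[y in RHS]opprK (mem_map (@oppr_inj R)) !rootE contin_opp.
  by rewrite mulf_eq0 signr_eq0.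
rewrite nth_rev ?size_map ?size_iota// -map_comp.
rewrite !(nth_map 0%N) ?size_iota ?nth_iota//=; try lia.
rewrite !add0n => xE.
suff : x (n - j.+1)%N < x j by lra.
by apply: xdec; lia.
Qed.

(** The recurrence has no negative term. This serves for the second half of an antisymmetric path,
    whose weights read from the far end are [- s k]. *)
Lemma contin_neg_gt0 (s : nat -> R) (x : R) n : 0 < x ->
  (forall k, (k < n)%N -> 0 <= s k) ->
  0 < contin x (fun k => - s k) n.+1 /\ 0 <= contin x (fun k => - s k) n.
Proof.
move=> x0; elim: n => [|n IH] s0; first by rewrite /= ltr01.
have [|p1 p0] := IH; first by move=> k kn; apply: s0; rewrite ltnW.
by split; [have := s0 n (ltnSn n); rewrite continSS; nra | exact: ltW].
Qed.

Lemma antisym_positive_roots (s : nat -> R) N :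
  (forall k, (k <= N)%N -> s (N - k)%N = - s k) ->
  s 0%N = 0 ->
  (forall k, (0 < k)%N -> (2 * k < N)%N -> 0 < s k) ->
  exists y : nat -> R,
    (forall i j, (i < j < N %/ 4)%N -> y j < y i) /\
    forall j, (j < N %/ 4)%N -> 0 < y j /\ contin (y j) s N.+1 = 0.
Proof.
move=> asym s00 spos; pose n := (N %/ 2)%N.
have nN : (n <= N)%N by exact: leq_div.
have [k /andP[k0 kn]|x [xdec xP]] := @cpoly_positive_roots s n.
  by apply: spos => //; rewrite /n in kn; lia.
have N4 : (N %/ 4 = n %/ 2)%N by rewrite /n -divnMA.
(* For even [N] the middle bond has weight [s n = 0], so the half continuant divides the full
   one. *)
have [Ne|No] := eqVneq N (2 * n)%N.
  exists x; split=> [i j /andP[ij jm]|j]; first by apply: xdec; lia.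
  rewrite N4 => /xP[x0 xroot _]; split=> //.
  rewrite (contin_split _ asym nN) (_ : (N - n)%N = n); last by lia.
  have sn : s n = 0 by have := asym _ nN; rewrite (_ : (N - n)%N = n); [lra|lia].
  by rewrite xroot sn; ring.
(* For odd [N] the cut is at bond [n.+1]. At [x j] there remains [- s n * contin (x j) s n] times
   the positive continuant of the far half, so the sign alternates with [j]. *)
have NE : N = (2 * n).+1 by move: No; rewrite /n; lia.
have alt j : (j < N %/ 4)%N -> 0 < (-1) ^+ j.+1 * (cpoly s N.+1).[x j].
  rewrite N4 => jm; have [x0 xroot xsgn] := xP _ jm.
  rewrite horner_cpoly (contin_split _ asym nN) (_ : (N - n)%N = n.+1); last by lia.
  have sn : s n.+1 = - s n by rewrite -(asym n nN); congr s; lia.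
  rewrite xroot continSS xroot.
  have sn0 : 0 < s n by apply: spos; lia.
  have [k kn|c0 _] := @contin_neg_gt0 s (x j) n x0.
    case: k kn => [|k] kn; first by rewrite s00.
    by apply/ltW/spos => //; lia.
  rewrite (_ : _ * _ = s n * contin (x j) (fun k => - s k) n.+1 *
     ((-1) ^+ j * contin (x j) s n)); last by rewrite exprS; ring.
  by apply: mulr_gt0 => //; apply: mulr_gt0.
have [|y yP] := alternating_roots (cpoly_monic s N) alt.
  by move=> i j /andP[ij jm]; apply: xdec; lia.
exists y; split=> [i j /andP[ij jm]|j jm].
  have [_ _ /(_ _ ij) yx] := yP _ jm.
  by have [_ xy _] := yP _ (ltn_trans ij jm); apply: lt_trans yx xy.
have [yroot xy _] := yP _ jm; split; last first.
  by rewrite -horner_cpoly; exact/eqP.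
by have [|x0 _ _] := xP j; [rewrite -N4 | apply: lt_trans xy].
Qed.

End PositiveRoots.

(** * Polynomials with a rotational symmetry *)

Lemma poly_ext (F : numFieldType) (p q : {poly F}) :
  (forall z, z != 0 -> p.[z] = q.[z]) -> p = q.
Proof.
move=> pq; apply/eqP; rewrite -subr_eq0; apply/eqP.
pose rs : seq F := [seq n.+1%:R | n <- iota 0 (size (p - q))].
apply: (@roots_geq_poly_eq0 _ _ rs); last by rewrite size_map size_iota.
  apply/allP => _ /mapP[n _ ->].
  by rewrite rootE !hornerE pq ?subrr// pnatr_eq0.
rewrite map_inj_uniq ?iota_uniq// => m n /eqP.
by rewrite eqr_nat => /eqP[].
Qed.

Lemma coef_scale_invariant (F : numFieldType) (p : {poly F}) (a b : F) :
  (forall z, z != 0 -> p.[a * z] = b * p.[z]) ->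
  forall k, a ^+ k * p`_k = b * p`_k.
Proof.
move=> inv k; have [kp|pk] := ltnP k (size p); last by rewrite nth_default// !mulr0.
have : \poly_(k < size p) (a ^+ k * p`_k) = b *: p.
  apply: poly_ext => z z0; rewrite hornerZ -inv// horner_poly horner_coef.
  by apply: eq_bigr => i _; rewrite exprMn; ring.
by move=> /(congr1 (fun q : {poly F} => q`_k)); rewrite coef_poly kp coefZ.
Qed.

(* The symmetry forces all exponents of [Q] to be congruent to [N] modulo 4. *)
Lemma quartic_factorization (F : numFieldType) (i0 : F) (Q : {poly F}) N
    (c : nat -> F) :
  4.-primitive_root i0 -> Q \is monic -> size Q = N.+1 ->
  (forall z, z != 0 -> Q.[i0 * z] = i0 ^+ N * Q.[z]) ->
  (forall j, (j < N %/ 4)%N -> c j != 0 /\ root Q (c j)) ->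
  (forall i j, (i < j < N %/ 4)%N -> c i ^+ 4 != c j ^+ 4) ->
  Q = 'X^(N - 4 * (N %/ 4)) * \prod_(j < N %/ 4) ('X^4 - (c j ^+ 4)%:P).
Proof.
move=> i0P Qmon szQ inv croot cinj.
set m := (N %/ 4)%N; set r := (N - 4 * m)%N.
have rE : r = (N %% 4)%N by rewrite /r /m; lia.
have Q0 k : k != N %[mod 4] -> Q`_k = 0.
  move=> kN; have /eqP := coef_scale_invariant inv k.
  rewrite -subr_eq0 -mulrBl mulf_eq0 subr_eq0 (eq_prim_root_expr i0P) (negPf kN).
  by move=> /eqP.
(* [Q] is ['X^r] times [H] evaluated at ['X^4]. As [H] is monic of degree [m], the [m] distinct
   values [c j ^+ 4] are all its roots. *)
pose H := \poly_(k < m.+1) Q`_(r + 4 * k).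
have QE : Q = 'X^r * (H \Po 'X^4).
  apply/polyP => k; rewrite coefXnM coef_comp_poly_Xn// coef_poly.
  case: ltnP => kr; first by rewrite Q0//; lia.
  case: ifP => [dvd|ndvd]; last by apply: Q0; lia.
  have -> : (r + 4 * ((k - r) %/ 4))%N = k by lia.
  by case: ltnP => // km; rewrite nth_default// szQ; lia.
have Hm : H`_m = 1.
  rewrite coef_poly ltnSn (_ : (r + 4 * m)%N = N); last by rewrite /r; lia.
  by move: Qmon; rewrite monicE lead_coefE szQ => /eqP.
have szH : size H = m.+1.
  apply/eqP; rewrite eqn_leq size_poly /= ltnNge; apply/negP => le.
  by move: Hm; rewrite nth_default// => /eqP; rewrite eq_sym oner_eq0.
have HE : H = \prod_(z <- map (fun j => c j ^+ 4) (iota 0 m)) ('X - z%:P).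
  rewrite [LHS](@all_roots_prod_XsubC _ H (map (fun j => c j ^+ 4) (iota 0 m))).
  - by rewrite lead_coefE szH Hm scale1r.
  - by rewrite size_map size_iota.
  - apply/allP => _ /mapP[j + ->]; rewrite mem_iota add0n => /croot[cj].
    rewrite QE rootM {1}/root hornerXn expf_eq0 (negPf cj) andbF /=.
    by rewrite /root horner_comp hornerXn.
  - rewrite uniq_rootsE map_inj_in_uniq ?iota_uniq// => i j.
    rewrite !mem_iota !add0n => im jm ecc.
    have [ij|ji|//] := ltngtP i j.
      by have := cinj i j; rewrite ij jm ecc eqxx => /(_ isT).
    by have := cinj j i; rewrite ji im ecc eqxx => /(_ isT).
rewrite QE; congr (_ * _); rewrite HE big_map.
have -> : iota 0 m = index_iota 0 m by rewrite /index_iota subn0.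
rewrite big_mkord.
rewrite -[LHS]/(comp_poly _ _) rmorph_prod; apply: eq_bigr => j _ /=.
by rewrite comp_polyB comp_polyX comp_polyC.
Qed.

(** * Determinants with polynomial and Laurent polynomial entries *)

Section DetPoly.
Variable F : numFieldType.

Lemma size_coef_prod (I : Type) (r : seq I) (P : I -> {poly F}) d :
  (forall i, (size (P i) <= d.+1)%N) ->
  (size (\prod_(i <- r) P i)%R <= (size r * d).+1)%N /\
  (\prod_(i <- r) P i)`_(size r * d) = \prod_(i <- r) (P i)`_d.
Proof.
move=> szP; elim: r => [|a r [szr cr]].
  by rewrite !big_nil size_poly1 mul0n coef1.
rewrite !big_cons /= mulSn; split.
  apply: leq_trans (size_polyMleq _ _) _.
  by have := szP a; move: szr; set u := size _; set v := size _; lia.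
rewrite coefM (bigD1 (inord d)) //= inordK ?ltnS ?leq_addr// addKn cr.
rewrite [X in _ + X]big1 ?addr0// => k; rewrite -val_eqE /= inordK ?ltnS ?leq_addr// => kd.
have [kd'|dk] := ltnP d k.
  by rewrite (nth_default _ (leq_trans (szP a) _))// mul0r.
by rewrite [X in _ * X]nth_default ?mulr0// (leq_trans szr)//; lia.
Qed.

(** Holds term by term in the Leibniz expansion; [d] is only a bound, so the top coefficient may
    vanish. *)
Lemma det_poly_top n (M : 'M[{poly F}]_n) d :
  (forall i j, (size (M i j) <= d.+1)%N) ->
  (size (\det M) <= (n * d).+1)%N /\
  (\det M)`_(n * d) = \det (\matrix_(i, j) (M i j)`_d).
Proof.
move=> szM.
have H (s : 'I_n -> 'I_n) := @size_coef_prod _ (index_enum 'I_n) _ d (fun i => szM i (s i)).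
have sz : size (index_enum 'I_n) = n by rewrite /index_enum -enumT size_enum_ord.
rewrite sz in H; split.
  apply: leq_trans (size_sum _ _ _) _; apply/bigmax_leqP => s _.
  by rewrite size_Msign; case: (H s).
rewrite coef_sum; apply: eq_bigr => s _; rewrite !mulr_sign.
have [_ cs] := H s.
rewrite (eq_bigr (fun i => (M i (s i))`_d)); last by move=> i _; rewrite mxE.
by case: ifP => _; rewrite ?coefN cs.
Qed.

(** Multiplication by [t ^+ n] gives a polynomial of degree at most [2 * n]. Invariance under [om]
    leaves only the exponents 0, [n] and [2 * n], and the two extreme coefficients are [\det C] and
    [\det B]. *)
Lemma det_laurent n (A B C : 'M[F]_n) (om : F) :
  (0 < n)%N -> n.-primitive_root om ->
  (forall t, t != 0 -> \det (A + (om * t) *: B + (om * t)^-1 *: C) =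
                       \det (A + t *: B + t^-1 *: C)) ->
  exists c0, forall t, t != 0 ->
    \det (A + t *: B + t^-1 *: C) = c0 + t ^+ n * \det B + t ^- n * \det C.
Proof.
move=> n0 omP inv.
pose M := \matrix_(i < n, j < n)
  ((C i j)%:P + (A i j) *: 'X + (B i j) *: 'X^2 : {poly F}).
have horM t : map_mx (horner_eval t) M = C + t *: A + t ^+ 2 *: B.
  by apply/matrixP => i j; rewrite !mxE horner_evalE !hornerD !hornerZ hornerC hornerX hornerXn; ring.
have horG t : (\det M).[t] = \det (C + t *: A + t ^+ 2 *: B).
  by rewrite -horM det_map_mx.
have horG' t : t != 0 -> (\det M).[t] = t ^+ n * \det (A + t *: B + t^-1 *: C).
  move=> t0; rewrite horG -detZ; congr (\det _).
  by rewrite !scalerDr !scalerA divff// scale1r -expr2 [RHS]addrC addrA.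
have om0 : om != 0 by rewrite (prim_root_eq0 omP) -lt0n.
have invG k : om ^+ k * (\det M)`_k = 1 * (\det M)`_k.
  apply: coef_scale_invariant => t t0.
  rewrite mul1r !horG' ?mulf_neq0// inv// exprMn.
  by rewrite (prim_expr_order omP) mul1r.
have G0 k : ~~ (n %| k)%N -> (\det M)`_k = 0.
  move=> nk; have /eqP := invG k.
  rewrite -subr_eq0 -mulrBl mulf_eq0 subr_eq0 => /orP[|/eqP//].
  by rewrite -(prim_order_dvd omP) (negPf nk).
have [|szG topG] := @det_poly_top _ M 2.
  move=> i j; rewrite mxE; apply/leq_sizeP => k k3; rewrite !coefE.
  by case: k k3 => [|[|[|k]]] //=; rewrite !mulr0 !addr0.
have GE : \det M = (\det M)`_0 *: 1 + (\det M)`_n *: 'X^n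
                   + (\det M)`_(n * 2) *: 'X^(n * 2).
  apply/polyP => k; rewrite !coefD !coefZ coef1 !coefXn.
  case: (boolP (n %| k)%N) => [/dvdnP[q ->]|nk]; last first.
    have ne j : (n %| j)%N -> (k == j) = false.
      by move=> nj; apply: contraNF nk => /eqP->.
    by rewrite G0// !ne ?dvdn0 ?dvdn_mulr// !mulr0 !addr0.
  rewrite [(n * 2)%N]mulnC eqn_pmul2r// muln_eq0 (gtn_eqF n0) orbF.
  rewrite (_ : (q * n == n)%N = (q == 1%N)); last by rewrite -{2}[n]mul1n eqn_pmul2r.
  case: q => [|[|[|q]]]; rewrite /= ?mul0n ?mul1n ?mulr1 ?mulr0 ?addr0 ?add0r//.
  by rewrite nth_default// (leq_trans szG)// mulnC; nia.
set c0 := (\det M)`_n in GE; exists c0 => t t0.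
have tn0 : t ^+ n != 0 by rewrite expf_neq0.
apply: (mulfI tn0); rewrite -horG' // GE !hornerD !hornerZ -polyC1 hornerC !hornerXn topG.
have -> : \matrix_(i, j) (M i j)`_2 = B.
  by apply/matrixP => i j; rewrite !mxE !coefE /= mulr0 mulr1 !add0r.
have -> : (\det M)`_0 = \det C.
  by rewrite -horner_coef0 horG expr0n /= !scale0r !addr0.
by rewrite exprM; field.
Qed.

End DetPoly.

(** * Determinants of open and periodic Jacobi matrices *)

Section JacobiDet.
Variable K : comNzRingType.
Implicit Types (z : K) (f g : nat -> K).

(* Numbered from the last site, so that deleting the first row and column
   leaves the amplitudes unchanged. *)
Definition jacobi_mx z f g n : 'M[K]_n := \matrix_(i, j)
  if i == j then z
  else if j == i.+1 :> nat then - f (n.-1 - i)%N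
  else if i == j.+1 :> nat then - g (n.-1 - j)%N
  else 0.

Lemma jacobi_mx_minor z f g n :
  row' ord0 (col' ord0 (jacobi_mx z f g n.+1)) = jacobi_mx z f g n.
Proof.
apply/matrixP => i j; rewrite !mxE -!val_eqE /= /bump /= !add1n !eqSS.
by case: n i j => [[]//|n] i j; rewrite /= !subSS.
Qed.

Lemma det_jacobi_mx z f g n :
  \det (jacobi_mx z f g n) = contin z (fun k => f k * g k) n.+1.
Proof.
elim/nat_ind2: n => [||n IH0 IH1]; first by rewrite det_mx00.
  by rewrite det_mx11 mxE eqxx /=; ring.
rewrite continSS -IH0 -IH1 (expand_det_row _ ord0) !big_ord_recl big1; last first.
  by move=> k _; rewrite mxE /= mul0r.
rewrite /cofactor jacobi_mx_minor /= !mxE /= subn0 addr0 expr0 mul1r.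
congr (_ + _); rewrite (expand_det_col _ ord0) big_ord_recl big1; last first.
  by move=> k _; rewrite !mxE /= mul0r.
rewrite addr0 /cofactor.
have -> : row' ord0 (col' ord0 (row' ord0 (col' (lift ord0 ord0)
            (jacobi_mx z f g n.+2)))) = jacobi_mx z f g n.
  rewrite -[RHS]jacobi_mx_minor -[in RHS]jacobi_mx_minor.
  by apply/matrixP => i j; rewrite !mxE -!val_eqE /= /bump /= !add1n.
by rewrite !mxE /= ?subn0 ?expr0 /bump /=; ring.
Qed.

(** The determinant is affine in the corner entry. The minor of the corner is upper triangular with
    diagonal entries [- g k.+1], and the cofactor sign cancels their signs. *)
Lemma det_jacobi_corner z f g c n :
  \det (jacobi_mx z f g n.+2 - c *: delta_mx ord0 ord_max) =
  contin z (fun k => f k * g k) n.+3 - c * \prod_(k < n.+1) g k.+1.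
Proof.
rewrite -det_jacobi_mx !(expand_det_row _ ord0).
set J := jacobi_mx _ _ _ _; set J' := J - _.
have cofE j : cofactor J' ord0 j = cofactor J ord0 j.
  congr (_ * \det _); apply/matrixP => k l; rewrite !mxE -val_eqE /= .
  by rewrite mulr0 subr0.
have J'E j : J' ord0 j = J ord0 j - c * (j == ord_max)%:R.
  by rewrite /J'; move: (J) => J0; rewrite !mxE eqxx.
under eq_bigr => j _ do rewrite cofE J'E mulrBl.
rewrite sumrB; congr (_ - _).
rewrite (bigD1 ord_max)//= eqxx mulr1 big1 ?addr0; last first.
  by move=> j /negPf ->; rewrite mulr0 mul0r.
congr (_ * _); rewrite /cofactor -det_tr det_trig; last first.
  apply/is_trig_mxP => k l kl; rewrite !mxE -!val_eqE /= /bump /= !add1n.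
  rewrite [(n.+1 <= k)%N]leqNgt ltn_ord add0n eqSS.
  by move: (nat_of_ord k) (nat_of_ord l) kl => a b ab; rewrite !ifF//; lia.
rewrite /= add0n -[X in (-1) ^+ X](card_ord n.+1) -prodr_const -big_split /=.
rewrite (reindex_inj rev_ord_inj) /=; apply: eq_bigr => k _.
rewrite !mxE -!val_eqE /= /bump /= !add1n.
rewrite subSS [(n < _)%N]ltnNge leq_subr /= add0n eqxx.
rewrite !ifF; [|lia..].
by rewrite mulN1r opprK; congr g; have := ltn_ord k; lia.
Qed.

(** [F 0] is one of the two amplitudes on the bond closing the cycle; when it vanishes, a path and a
    single corner entry remain. *)
Lemma cyclic_jacobi_mx z (F G : nat -> K) n : F 0%N = 0 ->
  \matrix_(i < n.+3, j < n.+3) ((i == j)%:R * z - (i == ord_pred j)%:R * F j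
                                - (i == ordS j)%:R * G j) =
  jacobi_mx z (fun k => F (n.+3 - k)%N) (fun k => G (n.+2 - k)%N) n.+3
  - G n.+2 *: delta_mx ord0 ord_max.
Proof.
move=> F0; apply/matrixP => i j; rewrite !mxE -!val_eqE /=.
have predE : (i == ((j + n.+3).-1 %% n.+3)%N :> nat)%:R * F j = (j == i.+1 :> nat)%:R * F j.
  have [j0|j0] := posnP j; first by rewrite j0 F0 !mulr0.
  rewrite (_ : (j + n.+3).-1 = (j.-1 + n.+3)%N); last by lia.
  rewrite modnDr modn_small; last by have := ltn_ord j; lia.
  by congr (_%:R * _); rewrite -[in RHS](prednK j0) eqSS eq_sym.
rewrite predE; have := ltn_ord j; rewrite ltnS leq_eqVlt => /orP[/eqP jE|jn].
  rewrite jE modnn eqxx andbT; have := ltn_ord i; rewrite ltnS => iN.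
  have [->|i0] := eqVneq (i : nat) 0%N.
    by rewrite /=; ring.
  rewrite (_ : (i == n.+3 :> nat) = false); last by lia.
  have [->|ne] := eqVneq (i : nat) n.+2.
    by rewrite (_ : (n.+2 == n.+3) = false); [rewrite /=; ring | lia].
  have [iE|ne2] := eqVneq n.+2 i.+1; last by rewrite /=; ring.
  by rewrite (_ : (n.+3 - (n.+2 - i))%N = n.+2); [rewrite /=; ring | lia].
rewrite modn_small// (_ : (j == n.+2 :> nat) = false) ?andbF; last by lia.
have iN := ltn_ord i.
have [->|ne] := eqVneq (i : nat) j.
  rewrite (_ : (j == j.+1 :> nat) = false); [rewrite /=; ring | lia].
have [->|ne2] := eqVneq (j : nat) i.+1.
  rewrite (_ : (i == i.+2 :> nat) = false); last by lia.
  by rewrite (_ : (n.+3 - (n.+2 - i))%N = i.+1); [rewrite /=; ring | lia].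
have [ij|ne3] := eqVneq (i : nat) j.+1; last by rewrite /=; ring.
by rewrite (_ : (n.+2 - (n.+2 - j))%N = j); [rewrite /=; ring | lia].
Qed.

Lemma det_cyclic_jacobi z (F G : nat -> K) N : (3 <= N)%N -> F 0%N = 0 ->
  \det (\matrix_(i < N, j < N) ((i == j)%:R * z - (i == ord_pred j)%:R * F j
                                - (i == ordS j)%:R * G j)) =
  contin z (fun k => F (N - k)%N * G (N.-1 - k)%N) N.+1 - \prod_(k < N) G k.
Proof.
case: N => [|[|[|n]]]// _ F0; rewrite cyclic_jacobi_mx// det_jacobi_corner.
congr (_ - _); rewrite [RHS]big_ord_recr mulrC /=; congr (_ * _).
rewrite (reindex_inj rev_ord_inj) /=; apply: eq_bigr => k _.
by congr G; have := ltn_ord k; lia.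
Qed.

End JacobiDet.

(** * Phases and roots of unity *)

Section Model.
Variable R : realType.
Local Notation C := R[i].

(** With pi factored out, identities between phases become [field] identities between exponents, up
    to even integers. *)
Definition epi (x : R) : C := expi (pi * x).

Lemma epiD x y : epi (x + y) = epi x * epi y.
Proof.
rewrite /epi /expi mulrDr cosD sinD; apply/eqP.
by rewrite eq_complex /= eqxx /= addrC; apply/eqP; ring.
Qed.

Lemma epi0 : epi 0 = 1.
Proof. by rewrite /epi mulr0 /expi cos0 sin0. Qed.

Lemma epi1 : epi 1 = -1.
Proof.
rewrite /epi mulr1 /expi cospi sinpi; apply/eqP.
by rewrite eq_complex /= oppr0 !eqxx.
Qed.

Lemma epi_half : epi 2^-1 = 'i.
Proof. by rewrite /epi /expi cos_pihalf sin_pihalf. Qed.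

Lemma epiX x n : epi x ^+ n = epi (x * n%:R).
Proof.
elim: n => [|n IH]; first by rewrite expr0 mulr0 epi0.
by rewrite exprS IH -epiD -[n.+1%:R]natr1; congr epi; ring.
Qed.

Lemma epi_nat n : epi n%:R = (-1) ^+ n.
Proof. by rewrite -epi1 epiX mul1r. Qed.

Lemma epi2 : epi 2 = 1.
Proof. by rewrite epi_nat sqrrN expr1n. Qed.

Lemma epiMV x : epi x * epi (- x) = 1.
Proof. by rewrite -epiD subrr epi0. Qed.

Lemma epi_neq0 x : epi x != 0.
Proof.
by apply: contra_eqN (epiMV x) => /eqP->; rewrite mul0r eq_sym oner_eq0.
Qed.

Lemma epiV x : (epi x)^-1 = epi (- x).
Proof. by apply: (mulfI (epi_neq0 x)); rewrite epiMV divff ?epi_neq0. Qed.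

Lemma epi_shift2 x : epi (x + 2) = epi x.
Proof. by rewrite epiD epi2 mulr1. Qed.

Lemma epi_shift2n x n : epi (x + 2 * n%:R) = epi x.
Proof. by rewrite epiD -epiX epi2 expr1n mulr1. Qed.

Lemma re_epi x : (cos (pi * x))%:C = (epi x + epi (- x)) / 2.
Proof.
have -> : epi x + epi (- x) = 2 * (cos (pi * x))%:C.
  rewrite /epi /expi mulrN cosN sinN; apply/eqP.
  by rewrite eq_complex /=; apply/andP; split; apply/eqP; ring.
by rewrite [2 * _]mulrC mulfK// pnatr_eq0.
Qed.

Lemma im_epi x : 'i * (sin (pi * x))%:C = (epi x - epi (- x)) / 2.
Proof.
have -> : epi x - epi (- x) = 2 * ('i * (sin (pi * x))%:C).
  rewrite /epi /expi mulrN cosN sinN; apply/eqP.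
  by rewrite eq_complex /=; apply/andP; split; apply/eqP; ring.
by rewrite [2 * _]mulrC mulfK// pnatr_eq0.
Qed.

(** If a power with [k.+1 < N] were 1, the angle [pi * (k.+1 / N)] would have a double with cosine
    1, hence sine 0, although it lies strictly between 0 and pi. *)
Lemma epi_prim N : (0 < N)%N -> N.-primitive_root (epi (2 / N%:R)).
Proof.
move=> N0; have NR : N%:R != 0 :> R by rewrite pnatr_eq0 -lt0n.
apply/andP; split=> //; apply/forallP => k; rewrite unity_rootE epiX.
have [->|kN] := eqVneq k.+1 N; first by rewrite divfK// epi2 !eqxx.
rewrite eqbF_neg; apply/negP => /eqP [ce _].
have kN' : (k.+1 < N)%N by rewrite ltn_neqAle kN /=; exact: ltn_ord.
have : 0 < sin (pi * (k.+1%:R / N%:R) : R).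
  apply: sin_gt0_pi; rewrite mulr_gt0 ?pi_gt0 ?divr_gt0 ?ltr0n//=.
  by rewrite gtr_pMr ?pi_gt0// ltr_pdivrMr ?ltr0n// mul1r ltr_nat.
have := cos2Dsin2 (pi * (k.+1%:R / N%:R) : R).
have e : pi * (2 / N%:R * k.+1%:R) = (pi * (k.+1%:R / N%:R)) *+ 2 :> R.
  by rewrite -mulr_natl; ring.
move: ce; rewrite e cos_mulr2n -mulr_natl.
by set c := cos _; set s := sin _; nra.
Qed.

Lemma expi_pihalf_epi : expi (pi / 2) = epi 2^-1.
Proof. by []. Qed.

End Model.

(** * The Harper matrix and its chiral gauge *)

Section Chiral.
Variables (R : realType) (N : nat).
Hypothesis N3 : (3 <= N)%N.
Local Notation C := R[i].
Local Notation n1 k := ((k : nat)%:R / N%:R : R).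

Let N0 : (0 < N)%N. Proof. exact: leq_trans N3. Qed.
Let NR : N%:R != 0 :> R. Proof. by rewrite pnatr_eq0 -lt0n. Qed.

Definition cshift : 'M[C]_N := \matrix_(i, j) (i == ordS j)%:R.

Lemma shift_mx1 : shift_mx N 1 = cshift.
Proof.
apply/matrixP => i j; rewrite !mxE -val_eqE /= mul1r.
case: ltnP => jN; first by rewrite modn_small.
by rewrite (_ : j.+1 = N) ?modnn//; apply/eqP; rewrite eqn_leq jN ltn_ord.
Qed.

Lemma mul_cshift m (M : 'M[C]_(N, m)) i j : (cshift *m M) i j = M (ord_pred i) j.
Proof.
rewrite mxE (bigD1 (ord_pred i))//= mxE ord_predK eqxx mul1r big1 ?addr0//.
move=> k ki; rewrite mxE (_ : (i == _) = false) ?mul0r//.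
by apply: contraNF ki => /eqP->; rewrite ordSK.
Qed.

Lemma mul_cshift_tr m (M : 'M[C]_(N, m)) i j : (cshift^T *m M) i j = M (ordS i) j.
Proof.
rewrite mxE (bigD1 (ordS i))//= !mxE eqxx mul1r big1 ?addr0//.
by move=> k /negPf ki; rewrite !mxE ki mul0r.
Qed.

Lemma mulr_cshift m (M : 'M[C]_(m, N)) i j : (M *m cshift) i j = M i (ordS j).
Proof.
by rewrite -[M]trmxK -[cshift]trmxK -trmx_mul mxE mul_cshift_tr !mxE.
Qed.

Lemma invmx_cshift : invmx cshift = cshift^T.
Proof.
have e : cshift^T *m cshift = 1%:M.
  by apply/matrixP => i j; rewrite mul_cshift_tr !mxE (inj_eq (@ordS_inj N)).
have [_ u] := mulmx1_unit e.
by rewrite -[LHS]mul1mx -e -mulmxA mulmxV// mulmx1.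
Qed.

(** Removes the case distinction at the wrap-around of [ordS] and [ord_pred]. *)
Lemma periodic_mod (T : Type) (f : nat -> T) k :
  (forall x, f (x + N)%N = f x) -> f (k %% N)%N = f k.
Proof.
move=> per; rewrite [in RHS](divn_eq k N).
elim: (k %/ N)%N => [|q IH]; first by rewrite mul0n add0n.
by rewrite mulSn -addnA addnC per.
Qed.

Lemma clock_per k : epi (2 * (k + N)%N%:R / N%:R) = epi (2 * k%:R / N%:R) :> C.
Proof. by rewrite -[RHS]epi_shift2 natrD; congr epi; field. Qed.

(** Conjugation by this diagonal multiplies [cshift] by [epi (2 / N)] and [cshift^T] by its
    inverse. *)
Definition clock : 'rV[C]_N := \row_k epi (2 * n1 k).

Lemma clock_ordS (k : 'I_N) : clock 0 (ordS k) = epi (2 / N%:R) * clock 0 k.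
Proof.
rewrite !mxE !mulrA (@periodic_mod _ (fun x => epi (2 * x%:R / N%:R)) _ clock_per).
by rewrite -epiD -natr1; congr epi; field.
Qed.

(* Intertwines the twisted Harper matrix with its chiral gauge, in which the
   Weyl pair U, V is represented by (diagonal * shift) and shift. *)
Definition chirp (x y : R) : C := epi (x - x * (x + 2 + 2 * y) / N%:R).
Definition chirp_mx : 'M[C]_N := \matrix_(i, j) chirp i%:R j%:R.

(** The exponent changes by the even integer [- 2 * (x + 1 + y)]; the linear summand [x] in [chirp]
    is there to cancel a leftover [N]. *)
Lemma chirp_perl x y n : x + 1 + y = n%:R -> chirp (x + N%:R) y = chirp x y.
Proof.
move=> xy; rewrite /chirp -[LHS](epi_shift2n _ n) -xy; congr epi; field.
exact: NR.
Qed.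

Lemma chirp_perr n y : chirp n%:R (y + N%:R) = chirp n%:R y.
Proof.
by rewrite /chirp -[LHS](epi_shift2n _ n); congr epi; field.
Qed.

Lemma chirp_ordS (k j : 'I_N) :
  chirp_mx (ordS k) j = epi (1 - (2 * k%:R + 3 + 2 * j%:R) / N%:R) * chirp_mx k j.
Proof.
rewrite !mxE (@periodic_mod _ (fun x => chirp x%:R j%:R)); last first.
  by move=> x; rewrite natrD (@chirp_perl _ _ (x + 1 + j)%N)// !natrD.
by rewrite /chirp -epiD -natr1; congr epi; field.
Qed.

Lemma chirp_ord_pred (k j : 'I_N) :
  chirp_mx (ord_pred k) j =
  epi (- 1 + (2 * k%:R + 1 + 2 * j%:R) / N%:R) * chirp_mx k j.
Proof.
rewrite !mxE (@periodic_mod _ (fun x => chirp x%:R j%:R)); last first.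
  by move=> x; rewrite natrD (@chirp_perl _ _ (x + 1 + j)%N)// !natrD.
have -> : (k + N).-1%:R = (k%:R - 1) + N%:R :> R.
  by rewrite -subn1 natrB ?natrD; [ring | lia].
rewrite (@chirp_perl _ _ (k + j)%N); last by rewrite natrD; ring.
by rewrite /chirp -epiD; congr epi; field.
Qed.

Lemma chirp_ordSr (k j : 'I_N) :
  chirp_mx k (ordS j) = epi (- (2 * n1 k)) * chirp_mx k j.
Proof.
rewrite !mxE (@periodic_mod _ (fun y => chirp k%:R y%:R)); last first.
  by move=> y; rewrite natrD chirp_perr.
by rewrite /chirp -epiD -natr1; congr epi; field.
Qed.

Lemma chirp_ord_predr (k j : 'I_N) :
  chirp_mx k (ord_pred j) = epi (2 * n1 k) * chirp_mx k j.
Proof.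
by rewrite -[j in RHS]ord_predK chirp_ordSr mulrA epiMV mul1r.
Qed.

(** Up to a phase in each row this is a Fourier matrix, that is, a Vandermonde matrix at distinct
    roots of unity. *)
Lemma det_chirp_neq0 : \det chirp_mx != 0.
Proof.
pose a : 'rV[C]_N := \row_k epi (- (2 * n1 k)).
have -> : chirp_mx = diag_mx (\row_k chirp k%:R 0) *m (Vandermonde N a)^T.
  apply/matrixP => i j; rewrite mul_diag_mx !mxE epiX /chirp -epiD.
  by congr epi; field.
rewrite det_mulmx det_tr det_Vandermonde det_diag mulf_neq0//.
  by apply/prodf_neq0 => k _; rewrite mxE epi_neq0.
apply/prodf_neq0 => i _; apply/prodf_neq0 => j ij.
rewrite !mxE subr_eq0; apply: contraTneq ij => /(congr1 (fun z => z^-1)).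
rewrite !epiV !opprK => eij.
have := eq_prim_root_expr (@epi_prim R N N0) i j.
rewrite !epiX (_ : 2 / N%:R * i%:R = 2 * n1 i); last by ring.
rewrite (_ : 2 / N%:R * j%:R = 2 * n1 j); last by ring.
by rewrite eij eqxx !modn_small// => /esym/eqP ->; rewrite ltnn.
Qed.

Lemma det_intertwine (P X Y : 'M[C]_N) :
  \det P != 0 -> P *m X = Y *m P -> \det X = \det Y.
Proof.
move=> P0 /(congr1 determinant); rewrite !det_mulmx [RHS]mulrC.
exact: (mulfI P0).
Qed.

(** [chirp_mx] diagonalizes the shift; the exponents of the eigenvalues add up to [- (N - 1)]. *)
Lemma det_cshift : \det cshift = (-1) ^+ N.-1.
Proof.
rewrite (@det_intertwine chirp_mx _ (diag_mx (\row_k epi (- (2 * n1 k))))).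
- have prodE n : \prod_(k < n) epi (- (2 * n1 k)) = epi (- (n%:R * (n%:R - 1) / N%:R)).
    elim: n => [|n IH]; first by rewrite big_ord0 mul0r mul0r oppr0 epi0.
    by rewrite big_ord_recr IH /= -epiD -natr1; congr epi; field.
  rewrite det_diag (eq_bigr (fun k : 'I_N => epi (- (2 * n1 k)))); last first.
    by move=> k _; rewrite mxE.
  rewrite prodE (_ : _ / _ = N.-1%:R); last by rewrite -subn1 natrB//; field.
  by rewrite -epiV epi_nat -exprVn invrN1.
- exact: det_chirp_neq0.
- by apply/matrixP => i j; rewrite mulr_cshift chirp_ordSr mul_diag_mx !mxE.
Qed.

Let hi : C := epi 2^-1 / 2.

(** The twist is spread over all bonds: each hop carries [t] or [t^-1], so a full turn collects
    [t ^+ N]. *)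
Definition harper_mx (z t : C) : 'M[C]_N :=
  diag_mx (\row_k (z - (epi (2 * n1 k) + epi (- (2 * n1 k))) / 2))
  + t *: (- hi *: cshift) + t^-1 *: (- hi *: cshift^T).

Lemma horner_chi z : (chi N 1 (pi / 2) 0).[z] = \det (harper_mx z 1).
Proof.
rewrite /chi /char_poly -[LHS]/(horner_eval z _) -det_map_mx; congr (\det _).
rewrite /twisted_mx shift_mx1 invmx_cshift expi_pihalf_epi -/hi.
apply/matrixP => i j; rewrite !mxE /= horner_evalE hornerD hornerN hornerC.
rewrite hornerMn hornerX invr1 !mul1r addr0.
rewrite (_ : 2 * pi * _ / _ = pi * (2 * n1 i)); last by ring.
rewrite re_epi; case: (i == j); rewrite ?mulr1n ?mulr0n; ring.
Qed.

Lemma harper_twist z : exists c0, forall t, t != 0 ->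
  \det (harper_mx z t) = c0 - hi ^+ N * (t ^+ N + t ^- N).
Proof.
have [t t0|c0 c0E] := det_laurent N0 (@epi_prim R N N0)
   (A := diag_mx (\row_k (z - (epi (2 * n1 k) + epi (- (2 * n1 k))) / 2)))
   (B := - hi *: cshift) (C := - hi *: cshift^T).
  apply/esym/(@det_intertwine (diag_mx clock)).
    by rewrite det_diag; apply/prodf_neq0 => k _; rewrite mxE epi_neq0.
  apply/matrixP => i j.
  have e0 : (i == j)%:R * clock 0 i = (i == j)%:R * clock 0 j.
    by case: eqVneq => [->|_]; rewrite // !mul0r.
  have e1 : (i == ordS j)%:R * clock 0 i =
            epi (2 / N%:R) * ((i == ordS j)%:R * clock 0 j).
    by case: eqVneq => [->|_]; rewrite ?mul0r ?mulr0// !mul1r clock_ordS.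
  have e2 : (j == ordS i)%:R * clock 0 i =
            (epi (2 / N%:R))^-1 * ((j == ordS i)%:R * clock 0 j).
    case: eqVneq => [->|_]; rewrite ?mul0r ?mulr0// !mul1r clock_ordS.
    by rewrite mulKf ?epi_neq0.
  rewrite mul_diag_mx mul_mx_diag [LHS]mxE [RHS]mxE.
  move: (clock 0 i) (clock 0 j) e0 e1 e2 => ci cj e0 e1 e2; rewrite !mxE.
  move: (epi (2 / N%:R)) e1 e2 => om e1 e2; rewrite invfM -[(z - _) *+ _]mulr_natl.
  move: (z - _) (i == j)%:R (i == ordS j)%:R (j == ordS i)%:R e0 e1 e2.
  move=> d d0 d1 d2 e0 e1 e2.
  transitivity (d * (d0 * ci) - t * hi * (d1 * ci) - t^-1 * hi * (d2 * ci)); first by ring.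
  by rewrite e0 e1 e2; ring.
exists c0 => t t0; rewrite /harper_mx c0E// !detZ det_tr det_cshift.
have -> : (- hi) ^+ N * (-1) ^+ N.-1 = - hi ^+ N.
  rewrite [(- hi) ^+ N]exprNn (_ : (-1) ^+ N = - (-1) ^+ N.-1 :> C).
    by rewrite mulrAC mulNr -expr2 sqrr_sign mulN1r.
  by rewrite -[in LHS](prednK N0) exprS mulN1r.
by ring.
Qed.

(** Here [- 2^-1] cancels the phase of [hi], and [- N^-1] the summand 1 in the numerator of
    [chirp_ord_pred]. This makes [F 0] vanish. *)
Let t0 : C := epi (- 2^-1 - N%:R^-1).
Let F (j : nat) : C := (1 - epi (2 * n1 j)) / 2.
Let G (j : nat) : C := (1 + epi (- (2 * n1 j.+1))) / 2.

(** Column shifts of the chirp produce [u] and [v]. In [u * F j + v * G j] the constant halves give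
    the cosine diagonal, and the parts with [x] and [y] match the row shifts, which are the Harper
    hops. *)
Lemma harper_chiral z :
  \det (harper_mx z t0) = \det (\matrix_(i < N, j < N)
     ((i == j)%:R * z - (i == ord_pred j)%:R * F j - (i == ordS j)%:R * G j)).
Proof.
apply/esym/(det_intertwine det_chirp_neq0)/matrixP => k j.
have sumE (l : 'I_N) x :
    \sum_i chirp_mx k i * ((i == l)%:R * x) = chirp_mx k l * x.
  rewrite (bigD1 l)//= eqxx mul1r big1 ?addr0// => i /negPf->.
  by rewrite mul0r mulr0.
rewrite !mulmxDl mxE (eq_bigr (fun i => chirp_mx k i * ((i == j)%:R * z)
    - chirp_mx k i * ((i == ord_pred j)%:R * F j)
    - chirp_mx k i * ((i == ordS j)%:R * G j))); last first.
  by move=> i _; rewrite [X in _ * X]mxE !mulrBr.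
rewrite !sumrB !sumE -!scalemxAl mul_diag_mx.
have e A B D : (A + B + D : 'M[C]_N) k j = A k j + B k j + D k j.
  by rewrite !mxE.
have eZ a (A : 'M[C]_N) : (a *: A) k j = a * A k j by rewrite mxE.
rewrite e !eZ mul_cshift mul_cshift_tr [X in _ = X + _ + _]mxE [X in _ = X * _ + _ + _]mxE.
rewrite chirp_ordSr chirp_ord_predr chirp_ordS chirp_ord_pred.
set p := chirp_mx k j.
pose u := epi (2 * n1 k) : C; pose v := epi (- (2 * n1 k)) : C.
pose x := epi (2 * n1 j) : C; pose y := epi (- (2 * n1 j.+1)) : C.
have h1 : epi 2^-1 * t0 * epi (- 1 + (2 * k%:R + 1 + 2 * j%:R) / N%:R) = - (u * x).
  rewrite -[RHS]mulN1r -epi1 -!epiD -[LHS]epi_shift2.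
  by congr epi; field.
have h2 : epi 2^-1 * t0^-1 * epi (1 - (2 * k%:R + 3 + 2 * j%:R) / N%:R) = v * y.
  rewrite epiV -!epiD -[RHS]epi_shift2 -natr1.
  by congr epi; field.
rewrite /F /G /hi -/u -/v -/x -/y.
set a1 := epi (-1 + _) in h1 *; set a2 := epi (1 - _) in h2 *.
have -> : t0 * (- (epi 2^-1 / 2) * (a1 * p)) = - (epi 2^-1 * t0 * a1) * p / 2 by ring.
have -> : t0^-1 * (- (epi 2^-1 / 2) * (a2 * p)) = - (epi 2^-1 * t0^-1 * a2) * p / 2.
  by ring.
by rewrite h1 h2 {h1 h2}; move: u v x y p => u' v' x' y' p'; field.
Qed.

(** The factorization of ['X^N - 1] over the roots of unity, evaluated at -1. *)
Lemma prod_G : \prod_(k < N) G k = (1 - epi N%:R) / 2 ^+ N.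
Proof.
have -> : \prod_(k < N) G k = \prod_(k < N) ((1 + epi (2 / N%:R) ^+ k) / 2).
  rewrite (reindex_inj rev_ord_inj) /=; apply: eq_bigr => k _.
  rewrite /G epiX; congr ((1 + _) / 2).
  rewrite (_ : (N - k.+1).+1%:R = N%:R - k%:R :> R).
    by rewrite -[LHS]epi_shift2; congr epi; field.
  by rewrite -natrB ?subnSK// ltnW.
rewrite big_split /= prodr_const card_ord exprVn; congr (_ / _).
have := congr1 (fun p : {poly C} => p.[-1]) (factor_Xn_sub_1 (@epi_prim R N N0)).
rewrite horner_prod big_mkord hornerD hornerN hornerXn hornerC -epi_nat => e.
have -> : 1 - epi N%:R = epi N%:R * (epi N%:R - 1) :> C.
  by rewrite mulrBr mulr1 epi_nat -expr2 sqrr_sign.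
have s1 : epi N%:R = \prod_(k < N) (-1) :> C.
  by rewrite prodr_const card_ord epi_nat.
rewrite -e s1 -big_split; apply: eq_bigr => k _ /=.
by rewrite hornerXsubC mulN1r opprB opprK addrC.
Qed.

(** [harper_twist] is used at [t0], where the determinant is a continuant minus [prod_G], and at 1,
    where it is [chi]. On eliminating [c0], all constants cancel. *)
Lemma Qpoly_contin z : (Qpoly N (pi / 2)).[z] =
  contin z (fun k => (epi (2 * n1 k) - epi (- (2 * n1 k))) / 4) N.+1.
Proof.
have F0 : F 0 = 0 by rewrite /F mul0r mulr0 epi0 subrr mul0r.
have [c0 c0E] := harper_twist z.
have := c0E t0 (epi_neq0 _).
rewrite harper_chiral det_cyclic_jacobi// prod_G.
rewrite (@eq_contin _ _ _ (fun k => (epi (2 * n1 k) - epi (- (2 * n1 k))) / 4));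
  last first.
  move=> k kN; rewrite /F /G.
  have -> : 2 * n1 (N - k)%N = - (2 * n1 k) + 2.
    by rewrite natrB; [field | lia].
  have -> : - (2 * n1 (N.-1 - k).+1) = 2 * n1 k + 2 * (-1)%R.
    by rewrite (_ : (N.-1 - k).+1 = N - k)%N; [rewrite natrB; [field | lia] | lia].
  have -> : 2 * n1 k + 2 * -1 = 2 * n1 k - 2 by ring.
  rewrite -[epi (_ - 2)]epi_shift2 subrK epi_shift2.
  have := epiMV (2 * n1 k).
  move: (epi (2 * n1 k)) (epi (- (2 * n1 k))) => u v uv.
  transitivity ((1 - u * v + u - v) / 4); first by field.
  by rewrite uv; ring.
set W := contin _ _ _; move=> WE.
have hN : hi ^+ N = epi (N%:R / 2) / 2 ^+ N.
  by rewrite /hi expr_div_n epiX; congr (epi _ / _); ring.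
have t0N : t0 ^+ N = - epi (- (N%:R / 2)).
  by rewrite epiX -[RHS]mulN1r -epi1 -epiD -[LHS]epi_shift2; congr epi; field.
have t0VN : t0 ^- N = - epi (N%:R / 2).
  by rewrite t0N invrN epiV opprK.
rewrite /Qpoly hornerD hornerC horner_chi c0E ?oner_eq0// expr1n invr1.
have -> : 2 ^ (1 - N%:Z) = 2 / 2 ^+ N :> C.
  by rewrite expfzDr ?pnatr_eq0// expr1z -invr_expz.
have -> : expi (N%:R * (pi / 2)) = epi (N%:R / 2) :> C.
  by rewrite /epi mulrCA.
have aa : epi N%:R = epi (N%:R / 2) * epi (N%:R / 2) :> C.
  by rewrite -epiD; congr epi; field.
move: WE; rewrite hN t0VN t0N aa; have := epiMV (N%:R / 2 : R).
move: (epi (N%:R / 2)) (epi (- (N%:R / 2))) ((2 : C) ^+ N)^-1 => a b q ab WE.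
have -> : c0 = W - (1 - a * a) * q + a * q * (- b - a) by rewrite WE; ring.
transitivity (W + q * (1 - a * b)); first by ring.
by rewrite ab; ring.
Qed.

End Chiral.

(** * Real weights, quartic factors and the roots on the cross *)

Lemma mup_quartic (F : numFieldType) (z : F) :
  z != 0 -> mup z ('X^4 - (z ^+ 4)%:P) = 1%N.
Proof.
move=> z0.
have -> : 'X^4 - (z ^+ 4)%:P =
    ('X - z%:P) ^+ 1 * (('X + z%:P) * ('X^2 + (z ^+ 2)%:P)).
  by rewrite !rmorphXn /=; ring.
rewrite mupMl ?mup_XsubCX ?eqxx// rootM negb_or /root !hornerD hornerX !hornerC hornerXn.
by rewrite -!mulr2n !mulrn_eq0 /= expf_eq0 /= z0.
Qed.

Section Main.
Variable R : realType.
Local Notation C := R[i].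

(** A square root of [i / 2]: the substitution of [c * z] for [z] reduces the weights [i * sin / 2]
    to real ones. *)
Let c : C := epi 4^-1 * ((Num.sqrt 2)^-1)%:C.

Let c2 : c ^+ 2 = epi 2^-1 * (2^-1)%:C.
Proof.
rewrite exprMn epiX -rmorphXn exprVn sqr_sqrtr ?ler0n//.
by congr (epi _ * _); field.
Qed.

Let c4 : c ^+ 4 = - (4^-1)%:C.
Proof.
rewrite -[4%N]/(2 * 2)%N exprM c2 exprMn epiX -rmorphXn -[RHS]mulN1r -epi1.
by congr (epi _ * _%:C); field.
Qed.

(** As [v ^+ 2 = - u ^+ 2], the four fourth roots are [u] and [v] times plus or minus [y]. *)
Lemma cross_pi4_quartic (z : C) (y : R) :
  z ^+ 4 = (epi 4^-1 * y%:C) ^+ 4 -> cross_pi4 R z.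
Proof.
move=> zy; pose u : C := epi 4^-1; pose v : C := epi (3 / 4).
have uE : expi (pi / 4) = u by [].
have vE : expi (3 * pi / 4) = v by rewrite /v /epi -mulrA mulrCA.
have uv : v ^+ 2 = - u ^+ 2.
  by rewrite /u /v !epiX -[RHS]mulN1r -epi1 -epiD; congr epi; field.
have : (z - u * y%:C) * (z - u * (- y)%:C) * (z - v * y%:C) * (z - v * (- y)%:C) = 0.
  rewrite rmorphN.
  transitivity ((z ^+ 2 - u ^+ 2 * y%:C ^+ 2) * (z ^+ 2 - v ^+ 2 * y%:C ^+ 2)).
    by ring.
  rewrite uv; transitivity (z ^+ 4 - (u * y%:C) ^+ 4); first by ring.
  by rewrite zy subrr.
move/eqP; rewrite !mulf_eq0 !subr_eq0 -!orbA /cross_pi4 uE vE.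
case/or4P => /eqP ->.
- by left; exists y.
- by left; exists (- y).
- by right; exists y.
- by right; exists (- y).
Qed.

Variable N : nat.
Hypothesis N3 : (3 <= N)%N.
Let N0 : (0 < N)%N. Proof. exact: leq_trans N3. Qed.
Let NR : N%:R != 0 :> R. Proof. by rewrite pnatr_eq0 -lt0n. Qed.

Let s (k : nat) : R := sin (pi * (2 * (k%:R / N%:R))).

Let s_antisym k : (k <= N)%N -> s (N - k)%N = - s k.
Proof.
move=> kN; rewrite /s natrB// (_ : pi * _ = pi *+ 2 - pi * (2 * (k%:R / N%:R))).
  by rewrite -sinN -[RHS]sinD2pi; congr sin; ring.
by rewrite -mulr_natr; field.
Qed.

Let s_gt0 k : (0 < k)%N -> (2 * k < N)%N -> 0 < s k.
Proof.
move=> k0 kN; apply: sin_gt0_pi.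
apply/andP; split.
  by rewrite mulr_gt0 ?pi_gt0// mulr_gt0// divr_gt0// ltr0n.
rewrite gtr_pMr ?pi_gt0// mulrA ltr_pdivrMr ?ltr0n// mul1r.
by rewrite -natrM ltr_nat.
Qed.

Lemma Qpoly_contin_real (z : C) : (Qpoly N (pi / 2)).[z] =
  contin z (fun k => c ^+ 2 * (s k)%:C) N.+1.
Proof.
rewrite Qpoly_contin//; apply: eq_contin => k _; rewrite c2.
rewrite fmorphV rmorph_nat mulrAC epi_half im_epi.
by field.
Qed.

(** Reversal of the path negates the weights, and rescaling by [i] negates them back. *)
Lemma Qpoly_rot (z : C) : (Qpoly N (pi / 2)).[epi 2^-1 * z] =
  epi 2^-1 ^+ N * (Qpoly N (pi / 2)).[z].
Proof.
rewrite !Qpoly_contin_real contin_antisym; last first.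
  by move=> k kN; rewrite s_antisym// rmorphN mulrN.
apply: (mulfI (@epi_neq0 R 2^-1)); rewrite mulrA -exprS -contin_scale.
congr (_ * _); apply: eq_contin => k _.
by rewrite epiX mulVf ?pnatr_eq0// epi1 mulN1r.
Qed.

Lemma Qpoly_monic_size :
  Qpoly N (pi / 2 : R) \is monic /\ size (Qpoly N (pi / 2 : R)) = N.+1.
Proof.
rewrite /Qpoly; set b := (_ + _ * _)%R.
have lt : (size b%:P < size (chi N 1%R (pi / 2 : R) 0%R))%N.
  by rewrite size_char_poly (leq_ltn_trans (size_polyC_leq1 _)).
split; last by rewrite size_polyDl// size_char_poly.
by rewrite monicE lead_coefDl// -monicE char_poly_monic.
Qed.

Lemma Qpoly_roots : exists y : nat -> R,
  [/\ forall i j, (i < j < N %/ 4)%N -> y j < y i,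
      forall j, (j < N %/ 4)%N -> 0 < y j
    & Qpoly N (pi / 2) = 'X^(N - 4 * (N %/ 4)) *
        \prod_(j < N %/ 4) ('X^4 - ((c * (y j)%:C) ^+ 4)%:P)].
Proof.
have s00 : s 0 = 0 by rewrite /s mul0r !mulr0 sin0.
have [y [ydec yP]] := antisym_positive_roots s_antisym s00 s_gt0.
exists y; split=> // [j /yP[]//|].
have c0 : c != 0.
  have : c ^+ 4 != 0 by rewrite c4 oppr_eq0 fmorph_eq0 invr_eq0 pnatr_eq0.
  by rewrite expf_eq0.
have [Qmon szQ] := Qpoly_monic_size.
apply: (@quartic_factorization _ (epi 2^-1) _ N (fun j => c * (y j)%:C)) => //.
- by have := @epi_prim R 4 isT; congr (_.-primitive_root (epi _)); field.
- by move=> z _; apply: Qpoly_rot.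
- move=> j /yP[y0 yroot]; split; first by rewrite mulf_neq0// fmorph_eq0 gt_eqF.
  rewrite /root Qpoly_contin_real; apply/eqP/(mulfI c0).
  rewrite contin_scale mulr0 (_ : contin _ _ _ = (contin (y j) s N.+1)%:C).
    by rewrite yroot mulr0.
  by rewrite rmorph_contin.
- move=> i j /andP[ij jm]; have yij : y j < y i by apply: ydec; rewrite ij.
  have [y0 _] := yP _ jm.
  rewrite [(c * (y i)%:C) ^+ 4]exprMn [(c * (y j)%:C) ^+ 4]exprMn.
  rewrite (inj_eq (mulfI _)) ?expf_neq0// -!rmorphXn (inj_eq (@complexI R)).
  by rewrite gt_eqF// (ltrXn2r 4 (ltW y0) yij).
Qed.

End Main.

Unset Implicit Arguments.

Theorem proposition3p3 (R : realType) (N : nat) (hN : (3 <= N)%N) :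
  let m := (N %/ 4)%N in
  let r := (N - 4 * m)%N in
  let Q : {poly R[i]} := Qpoly N (pi / 2) in
  [/\ r \in [:: 0; 1; 2; 3]%N,
      exists eta : 'I_m -> R,
        [/\ injective eta,
            forall j : 'I_m, 0 < eta j
          & Q = 'X^r * \prod_(j < m) ('X^4 + ((eta j)%:C)%:P)],
      forall z : R[i], root Q z -> z != 0 -> mup z Q = 1%N
    & [set z : R[i] | root Q z] `<=` cross_pi4 R].
Proof.
move=> m r Q; have [y [ydec y0 QE]] := Qpoly_roots R hN.
have c4y j : (epi 4^-1 * ((Num.sqrt 2)^-1)%:C * (y j)%:C) ^+ 4
    = - (y j ^+ 4 / 4)%:C :> R[i].
  rewrite -mulrA -rmorphM exprMn epiX -rmorphXn -[RHS]mulN1r -epi1.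
  congr (epi _ * _%:C); first by field.
  rewrite exprMn exprVn -[4%N]/(2 * 2)%N exprM sqr_sqrtr ?ler0n//.
  by field.
have yinj i j : (i < m)%N -> (j < m)%N -> y i ^+ 4 = y j ^+ 4 -> i = j.
  move=> im jm; have [ij|ji|//] := ltngtP i j.
    have := ydec i j; rewrite ij jm => /(_ isT) yij e.
    by have := ltrXn2r 4 (ltW (y0 _ jm)) yij; rewrite e ltxx.
  have := ydec j i; rewrite ji im => /(_ isT) yij e.
  by have := ltrXn2r 4 (ltW (y0 _ im)) yij; rewrite e ltxx.
have n4 : (4 : R)^-1 != 0 by rewrite invr_eq0 pnatr_eq0.
have rootP z : root Q z -> z != 0 ->
    exists j : 'I_m, z ^+ 4 = (epi 4^-1 * ((Num.sqrt 2)^-1)%:C * (y j)%:C) ^+ 4.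
  rewrite /Q QE rootM /root hornerXn expf_eq0 => + z0.
  rewrite (negPf z0) andbF /= horner_prod prodf_seq_eq0 => /hasP[j _ /=].
  by rewrite hornerD hornerN hornerXn hornerC subr_eq0 => /eqP; exists j.
split.
- by rewrite /r /m !inE; lia.
(* The zeros are [c * y j], and [c ^+ 4 = - 1 / 4]. *)
- exists (fun j => y j ^+ 4 / 4); split.
  + by move=> i j /(mulIf n4) e; apply/val_inj/(yinj _ _ (ltn_ord i) (ltn_ord j)).
  + by move=> j; rewrite divr_gt0// exprn_gt0//; exact: y0.
  + rewrite /Q QE; congr (_ * _); apply: eq_bigr => j _.
    by rewrite c4y polyCN opprK.
- move=> z rz z0; have [j zj] := rootP z rz z0.
  rewrite /Q QE mupMr; last by rewrite /root hornerXn expf_eq0 (negPf z0) andbF.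
  (* Only factor [j] vanishes at [z], because the [y k ^+ 4] are distinct, and its zero there is
     simple. *)
  rewrite (bigD1 j)//= -zj mupMl ?mup_quartic//.
  rewrite /root horner_prod prodf_seq_neq0; apply/allP => k _; apply/implyP => kj.
  rewrite hornerD hornerN hornerXn hornerC zj subr_eq0 !c4y eqr_opp.
  rewrite (inj_eq (@complexI R)) (inj_eq (mulIf n4)).
  by apply: contra kj => /eqP e; apply/eqP/val_inj/esym/(yinj _ _ (ltn_ord j) (ltn_ord k)).
- move=> z /= rz; have [->|z0] := eqVneq z 0.
    by left; exists 0; rewrite // mulr0.
  have [j zj] := rootP z rz z0.
  by apply: (@cross_pi4_quartic _ _ ((Num.sqrt 2)^-1 * y j)); rewrite rmorphM mulrA.
Qed.
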